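(* Let $\{X_i : i\in I\}$ be a family of non-empty $T_1$ spaces such that the product $X=\prod\{X_i : i\in I\}$ is $\sigma$-countably tight. Then only finitely many of the factors $X_i$ can have a nowhere dense weak P subset. In particular, all but finitely many of the factors $X_i$ are countably tight.
   Context: A space $Y$ is countably tight if whenever $A\subset Y$ and $y\in\overline{A}$ (closure in $Y$) there is a countable $B\subset A$ with $y\in\overline{B}$; a subspace is countably tight if it is so in its subspace topology. A space is $\sigma$-countably tight if it is the union of countably many countably tight subspaces. A non-empty subset $S$ of a space $Y$ is a weak P set (weak P subset) of $Y$ if $\overline{T}\cap S=\emptyset$ for every countable $T\subset Y\setminus S$. A subset is nowhere dense if its closure has empty interior. Products carry the product topology. *)

(* Defs.v *)
From mathcomp Require Import all_boot all_order all_algebra.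
From mathcomp Require Import all_classical all_reals all_analysis.

Set Implicit Arguments.
Unset Strict Implicit.
Unset Printing Implicit Defensive.

Local Open Scope classical_set_scope.

Definition countably_tight (Y : topologicalType) : Prop :=
  forall (A : set Y) (y : Y), closure A y ->
    exists B : set Y, [/\ B `<=` A, countable B & closure B y].

(* Each [F n] is viewed through [set_type], which carries the initial topology
   of the inclusion, i.e. the usual subspace topology.  This is not
   [subspace (F n)], whose carrier is all of [Y]. *)
Definition sigma_countably_tight (Y : topologicalType) : Prop :=
  exists F : nat -> set Y,
    \bigcup_n F n = [set: Y] /\ forall n, countably_tight (set_type (F n)).

Definition weak_P_set (Y : topologicalType) (S : set Y) : Prop :=
  S !=set0 /\
  forall T : set Y, countable T -> T `<=` ~` S -> closure T `&` S = set0.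

Definition nowhere_dense (Y : topologicalType) (S : set Y) : Prop :=
  interior (closure S) = set0.

(* Main.v *)
Require Import Defs.
From mathcomp Require Import all_boot all_order all_algebra.
From mathcomp Require Import all_classical all_reals all_analysis.

(* A nowhere dense weak P set already witnesses that its factor is not countably
   tight, so it suffices to bound the number of factors that are not countably
   tight.  Suppose there are infinitely many of them and the product is the
   union of countably tight sets [F n].  Build finite partial points, each
   extending the previous one, such that the cylinder over the [n.+1]st misses
   [F n]; a common extension then lies in no [F n].
   For one step take a fresh coordinate [j] and [s], [A] with [s] in the closure
   of [A] but of no countable subset of [A].  Either adding [s] at [j] already
   gives a cylinder missing [F n], or some [y] in [F n] extends it.  In the
   latter case projecting to [j] shows that [y] is not in the closure of
   [{x in F n | x j in A}]; so in some basic neighbourhood [W] of [y] no point of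
   [F n] has its [j]-th coordinate in [A], and it is enough to move [y j] into
   [A] inside [W] and freeze the finitely many coordinates restricted by [W]. *)

Local Open Scope classical_set_scope.

(** Nowhere density puts each point of [S] in the closure of the complement, while the weak P
    property keeps it out of the closure of every countable subset of that complement. *)
Lemma nowhere_dense_weak_P_not_countably_tight (Y : topologicalType)
    (S : set Y) :
  nowhere_dense S -> weak_P_set S -> ~ countably_tight Y.
Proof.
move=> ndS [[s Ss] wPS] ctY.
have clS : closure (~` S) s.
  move=> U Us; apply: contrapT => SU0.
  suff : interior (closure S) s by rewrite ndS.
  apply: filterS Us => x Ux; apply: subset_closure.
  by apply: contrapT => nSx; apply: SU0; exists x.
have [B [BS cB clB]] := ctY _ _ clS.
by have : (closure B `&` S) s by []; rewrite wPS.
Qed.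

Lemma not_countably_tightP (Y : topologicalType) :
  ~ countably_tight Y ->
  exists (A : set Y) (s : Y), closure A s /\
    forall B, B `<=` A -> countable B -> ~ closure B s.
Proof.
move=> nct; apply: contrapT => nA; apply: nct => A s clA.
apply: contrapT => nB; apply: nA; exists A, s; split=> // B BA cB clB.
by apply: nB; exists B.
Qed.

Lemma countably_tight_set_type (Y : topologicalType) (F A : set Y) (y : Y) :
  countably_tight (set_type F) -> F y -> A `<=` F -> closure A y ->
  exists B, [/\ B `<=` A, countable B & closure B y].
Proof.
move=> ctF Fy AF clA.
pose y' : set_type F := SigSub (mem_set Fy).
have clA' : closure (set_val @^-1` A : set (set_type F)) y'.
  move=> W [_ [[U oU <-] /= Uy UW]].
  have [a [Aa Ua]] : A `&` U !=set0 by apply: clA; exact: open_nbhs_nbhs.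
  by exists (SigSub (mem_set (AF _ Aa))); split=> //; apply: UW.
have [B [BA cB clB]] := ctF _ _ clA'.
exists (set_val @` B); split.
- by move=> _ [x Bx <-]; exact: BA.
- exact: sub_countable (card_image_le _ _) cB.
- move=> U Uy.
  have [x [Bx Ux]] : B `&` set_val @^-1` U !=set0.
    by apply: clB; apply: (@initial_continuous _ _ (set_val : set_type F -> Y)).
  by exists (set_val x); split=> //; exists x.
Qed.

Section product.
Context {I : Type} {X : I -> topologicalType}.
Implicit Types (x y p : prod_topology X) (D : set I) (F : set (prod_topology X)).

Definition agree D x y := forall i, D i -> x i = y i.

Lemma nbhs_coord y (i : I) (U : set (X i)) :
  nbhs (y i) U -> nbhs y [set x | U (x i)].
Proof.
move=> yU; have /cvg_sup/(_ i) := @cvg_refl _ (nbhs y).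
by apply; apply: (@initial_continuous _ _ (fun f : forall k, X k => f i)).
Qed.

(** The product topology is a supremum of initial topologies, so once the sets containing such a
    cylinder form a filter, its convergence to [y] can be checked one coordinate at a time. *)
Lemma nbhs_cylinder y (W : set (prod_topology X)) : nbhs y W ->
  exists (E : set I) (V : forall i, set (X i)),
    [/\ finite_set E, forall i, nbhs (y i) (V i) &
        forall x, (forall i, E i -> V i (x i)) -> W x].
Proof.
pose G : set_system (prod_topology X) := [set W |
  exists (E : set I) (V : forall i, set (X i)),
    [/\ finite_set E, forall i, nbhs (y i) (V i) &
        forall x, (forall i, E i -> V i (x i)) -> W x]].
have FG : Filter G.
  split.
  - exists set0, (fun=> setT); split=> // i; exact: filterT.
  - move=> P Q [E [V [fE nV EP]]] [E' [V' [fE' nV' EQ]]].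
    exists (E `|` E'), (fun i => V i `&` V' i); split.
    + by rewrite finite_setU.
    + by move=> i; exact: filterI.
    + move=> x xV; split; [apply: EP|apply: EQ] => i Ei.
        by have [] := xV i (or_introl Ei).
      by have [] := xV i (or_intror Ei).
  - move=> P Q PQ [E [V [fE nV EP]]]; exists E, V; split=> // x /EP; exact: PQ.
suff : G --> y by apply.
apply/cvg_sup => i P [_ [[U oU <-] /= Uy UP]].
(* Transport along [k = i] makes [U] typecheck at every index; for other [k] the condition is
   vacuous and the factor is the whole space. *)
exists [set i], (fun k => [set z | forall e : k = i, U (eq_rect k X z i e)]).
split.
- exact: finite_set1.
- move=> k; have [e|ne] := pselect (k = i).
    subst k; apply: filterS (open_nbhs_nbhs (conj oU Uy)) => z Uz e.
    by rewrite (Prop_irrelevance e erefl).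
  by apply: filterS filterT => z _ e; case: (ne e).
- by move=> x xV; apply: UP; exact: (xV i erefl erefl).
Qed.

Lemma cylinder_escape F D p (j : I) :
  countably_tight (set_type F) -> finite_set D -> ~ D j ->
  ~ countably_tight (X j) ->
  exists D' p', [/\ finite_set D', D `<=` D', agree D p' p &
    forall x, F x -> ~ agree D' x p'].
Proof.
move=> ctF fD nDj /not_countably_tightP [A [s [clA nclA]]].
(* [{classic I}] supplies the decidable equality that [dfwith] needs. *)
pose upd (q : prod_topology X) z : prod_topology X :=
  @dfwith {classic I} X q j z.
have updj q z : upd q z j = z by exact: (@dfwithin {classic I}).
have updD q z i : i <> j -> upd q z i = q i.
  by move=> ij; apply: (@dfwithout {classic I}); apply/eqP => /esym.
have Dj i : D i -> i <> j by move=> Di ij; apply: nDj; rewrite -ij.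
have fDj : finite_set (D `|` [set j]) by rewrite finite_setU.
have [[y [Fy ysp]]|nF] :=
    pselect (exists y, F y /\ agree (D `|` [set j]) y (upd p s)); last first.
  exists (D `|` [set j]), (upd p s); split=> //.
  - by move=> i Di; rewrite updD//; exact: Dj.
  - by move=> x Fx xsp; apply: nF; exists x.
have yj : y j = s by rewrite ysp ?updj//; right.
have ncl : ~ closure (F `&` [set x | A (x j)]) y.
  move=> cl.
  have [B [BF cB clB]] :=
    @countably_tight_set_type _ _ _ _ ctF Fy (@subIsetl _ _ _) cl.
  apply: (nclA [set x j | x in B]).
  - by move=> _ [x Bx <-]; have [] := BF _ Bx.
  - exact: sub_countable (card_image_le _ _) cB.
  - rewrite -yj => U yU; have [x [Bx Ux]] := clB _ (@nbhs_coord _ _ _ yU).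
    by exists (x j); split=> //; exists x.
have {ncl} [W yW WF] : exists2 W, nbhs y W &
    forall x, W x -> F x -> ~ A (x j).
  apply: contrapT => nW; apply: ncl => W yW; apply: contrapT => FW.
  by apply: nW; exists W => // x Wx Fx Ax; apply: FW; exists x.
have [E [V [fE yV EW]]] := @nbhs_cylinder _ _ yW.
have [a [Aa Va]] : A `&` V j !=set0 by apply: clA; rewrite -yj.
exists (D `|` [set j] `|` E), (upd y a); split.
- by rewrite finite_setU.
- by move=> i Di; left; left.
- move=> i Di; have ij := Dj _ Di.
  by rewrite updD// ysp ?updD//; left.
(* On [E] the coordinates of [x] are [a] at [j] and those of [y] elsewhere, so [x] is in [W]; but
   [x j = a] is in [A]. *)
- move=> x Fx xya; apply: (WF x) => //; last first.
    by rewrite xya ?updj//; left; right.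
  apply: EW => i Ei; rewrite xya; last by right.
  have [->|ij] := pselect (i = j); first by rewrite updj.
  by rewrite updD//; exact: nbhs_singleton.
Qed.

Lemma exists_agree (D : nat -> set I) (p : nat -> prod_topology X) :
  (forall n, D n `<=` D n.+1) -> (forall n, agree (D n) (p n.+1) (p n)) ->
  exists x, forall n, agree (D n) x (p n).
Proof.
move=> DS pS.
have Dle m n : (m <= n)%N -> D m `<=` D n.
  move=> /subnK <-; elim: (n - m)%N => // k IH i Di.
  by rewrite addSn; apply/DS/IH.
have ple m n : (m <= n)%N -> agree (D m) (p n) (p m).
  move=> /subnK <-; elim: (n - m)%N => // k IH i Di.
  rewrite addSn pS ?IH//; apply: Dle Di; exact: leq_addl.
have xP i : {z : X i | forall n, D n i -> z = p n i}.
  apply: cid; have [[m Dmi]|nD] := pselect (exists m, D m i); last first.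
    by exists (p 0%N i) => n Dni; case: nD; exists n.
  exists (p m i) => n Dni.
  by case/orP: (leq_total m n) => [mn|nm]; [rewrite (ple m n)|rewrite (ple n m)].
by exists (fun i => sval (xP i)) => n i Dni; exact: (svalP (xP i)).
Qed.

Lemma sigma_countably_tight_product :
  (forall i, [set: X i] !=set0) -> sigma_countably_tight (prod_topology X) ->
  finite_set [set i | ~ countably_tight (X i)].
Proof.
move=> X0 [F [FT ctF]]; apply: contrapT => infJ.
have p0 : prod_topology X := fun i => sval (cid (X0 i)).
(* Finiteness sits under the existential so that [choice] gives a total [step]; the index [n] is
   carried to select the [F n] to escape. *)
have stepP (nDp : nat * (set I * prod_topology X)) :
    exists Dp' : set I * prod_topology X, finite_set nDp.2.1 ->
    [/\ finite_set Dp'.1, nDp.2.1 `<=` Dp'.1, agree nDp.2.1 Dp'.2 nDp.2.2 &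
      forall x, F nDp.1 x -> ~ agree Dp'.1 x Dp'.2].
  case: nDp => n [D p] /=; have [fD|nfD] := pselect (finite_set D); last first.
    by exists (D, p) => /nfD.
  have [j [nctj nDj]] := infinite_setN0 (infinite_setD infJ fD).
  have [D' [p' ?]] := @cylinder_escape _ _ p _ (ctF n) fD nDj nctj.
  by exists (D', p').
have [step {}stepP] := choice stepP.
pose Dp n := iteri n (fun m q => step (m, q)) (set0, p0).
have fD n : finite_set (Dp n).1.
  by elim: n => [|n IH]; [exact: finite_set0|case: (stepP (n, Dp n) IH)].
have DpS n := stepP (n, Dp n) (fD n).
have [||x xDp] := @exists_agree (fun n => (Dp n).1) (fun n => (Dp n).2).
- by move=> n; case: (DpS n).
- by move=> n; case: (DpS n).
have [n _ Fnx] : (\bigcup_n F n) x by rewrite FT.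
(* The cylinder at stage [n.+1] is the one built to miss [F n]. *)
by have [_ _ _ /(_ x Fnx)] := DpS n; apply; exact: (xDp n.+1).
Qed.

End product.

Theorem corollary5p3 (I : Type) (X : I -> topologicalType)
    (X_nonempty : forall i, [set: X i] !=set0)
    (X_T1 : forall i, accessible_space (X i))
    (X_sct : sigma_countably_tight (prod_topology X)) :
  finite_set [set i | exists S : set (X i), nowhere_dense S /\ weak_P_set S]
  /\ finite_set [set i | ~ countably_tight (X i)].
Proof.
have fin := sigma_countably_tight_product X_nonempty X_sct.
split=> //; apply: sub_finite_set fin => i [S [ndS wPS]].
exact: nowhere_dense_weak_P_not_countably_tight ndS wPS.
Qed.
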